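(* Let $m,n$ be integers with $m,n\ge 10$ and $3\mid mn$. Then the rectangle $R(m,n)$ admits a faultfree tromino tiling whose horizontal crossing number and vertical crossing number are both less than or equal to $2$.
   Context: $R(m,n)$ denotes the rectangle with $m$ rows and $n$ columns of unit squares. A tromino is an L-shaped tromino, i.e. a $2\times 2$ block of unit squares with one unit square removed, in any of its four orientations. A tromino tiling of $R(m,n)$ is a partition of its unit squares into trominoes. A fault line of a tiling is a horizontal or vertical line that cuts the rectangle into two (nonempty) pieces and does not pass through any of the tiles. A tiling is faultfree if it has no fault line. A tromino crosses a grid line if the grid line passes through the interior of the tromino (i.e. the tromino has unit squares on both sides of the line). The number of crossings on a grid line is the number of trominoes of the tiling crossing it. The horizontal (respectively vertical) crossing number of a tiling is the minimum, over all horizontal (respectively vertical) grid lines lying strictly inside the rectangle, of the number of crossings on that grid line. *)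

(* Defs.v *)
From mathcomp Require Import all_boot.

Set Implicit Arguments.
Unset Strict Implicit.
Unset Printing Implicit Defensive.

(* The unit squares of R(m, n), as pairs (row, column). *)
Definition cell (m n : nat) : finType := ('I_m * 'I_n)%type.

Section Trominoes.
Variables m n : nat.
Implicit Types (a c : cell m n) (t : {set cell m n}) (T : {set {set cell m n}}).

(* The 2 x 2 block with corner a, truncated if a lies in the last row or
   column; [tromino] excludes that case. *)
Definition block a : {set cell m n} :=
  [set c : cell m n | (a.1 <= c.1 <= a.1.+1) && (a.2 <= c.2 <= a.2.+1)].

Definition tromino t : Prop :=
  exists a c, [/\ a.1.+1 < m, a.2.+1 < n, c \in block a & t = block a :\ c].

Definition tromino_tiling T : Prop :=
  partition T [set: cell m n] /\ (forall t, t \in T -> tromino t).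

(* The horizontal grid line k separates the rows i < k from the rows i >= k,
   and likewise for vertical lines and columns; the line is strictly inside
   the rectangle when 0 < k < m (resp. 0 < k < n). *)
Definition hcrosses (k : nat) t : bool :=
  [exists c in t, c.1 < k] && [exists c in t, k <= c.1].

Definition vcrosses (k : nat) t : bool :=
  [exists c in t, c.2 < k] && [exists c in t, k <= c.2].

Definition hcrossings T (k : nat) : nat := #|[set t in T | hcrosses k t]|.

Definition vcrossings T (k : nat) : nat := #|[set t in T | vcrosses k t]|.

(* Only grid lines matter: any other line meeting the interior of the
   rectangle passes through the interior of some unit square. *)
Definition hfault_line T (k : nat) : Prop :=
  0 < k < m /\ (forall t, t \in T -> ~~ hcrosses k t).

Definition vfault_line T (k : nat) : Prop :=
  0 < k < n /\ (forall t, t \in T -> ~~ vcrosses k t).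

Definition faultfree T : Prop :=
  forall k : nat, ~ hfault_line T k /\ ~ vfault_line T k.

(* Since no line has more than #|T| crossings, the default value #|T| does not
   affect the minimum as soon as there is an interior line. *)
Definition hcrossing_number T : nat :=
  \big[minn/#|T|]_(1 <= k < m) hcrossings T k.

Definition vcrossing_number T : nat :=
  \big[minn/#|T|]_(1 <= k < n) vcrossings T k.

End Trominoes.

(* Main.v *)
Require Import Defs.
From mathcomp Require Import all_boot.
From mathcomp Require Import zify.

Set Implicit Arguments.
Unset Strict Implicit.
Unset Printing Implicit Defensive.

(** An L-tromino is a 2 x 2 block minus one square, hence it is determined by
    the grid point at the centre of its block and by the missing square.  So a
    tiling can be recorded as a pattern: a function that attaches to each grid
    point either nothing or one of four missing squares.  In these terms
    everything becomes local or can be read off from the centres, the grid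
    points that carry a tromino:
    - a pattern without centres on the boundary is a tiling if and only if each
      square is covered exactly once from the four grid points at its corners;
    - a tromino crosses exactly one horizontal and one vertical grid line,
      the two lines through its centre.  So a line is a fault line if it
      carries no centre, and its number of crossings is its number of centres.
    [good_pattern_tiling] transfers these facts to sets of trominoes.

    Because the tiling condition is local, patterns can be pumped.  If the rows
    q and q + P of a pattern are equal, the strip of rows from q to q + P - 1
    can be repeated any number a of times (a = 0 removes the strip), and every
    square still sees around it four grid points which occur around some square
    of the original pattern; the same holds for columns, independently.
    Fault lines do not appear if each line of the base has a centre outside the
    strip of the other direction, and a line outside the strips keeps its few
    centres if they lie outside the strip too ([repeat_good_pattern]).

    By symmetry it suffices to treat 3 | m, so that m >= 12.  Columns are
    pumped with period 2, using 3 x 2 rectangles stacked along the strip; this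
    needs 3 | m, and reduces n to 10 or 11.  For even n the rows can be pumped
    with period 3, again by 3 x 2 rectangles.  For odd n a strip of height 3
    is not available, since its columns would have to pair up; a strip
    of height 6 is, and leaves m = 12 or 15.  Hence three base patterns, given
    explicitly and checked by computation, cover all rectangles.  In each
    direction the edge of the strip is a line with two crossings: the strip is
    straight except in one or two places, where it is shifted by one unit and
    its rectangles prevent the edge from being a fault line. *)

(** * Tilings as patterns on the grid points *)

(** [G i j] describes the grid point between the rows i - 1 and i and between
    the columns j - 1 and j.  The value [Some (x, y)] places there the tromino
    whose missing square is in the lower half of the block if [x], and in the
    right half if [y]. *)
Definition pattern := nat -> nat -> option (bool * bool).

Definition covers (v : option (bool * bool)) (x y : bool) : bool :=
  if v is Some h then h != (x, y) else false.

(** The square (i, j) is lower right of its upper left corner, and so on: its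
    position in the block of a corner is opposite to that corner. *)
Definition once (G : pattern) (i j : nat) : bool :=
  covers (G i j) true true + covers (G i j.+1) true false +
  covers (G i.+1 j) false true + covers (G i.+1 j.+1) false false == 1.

Definition tiling_pattern (m n : nat) (G : pattern) : Prop :=
  (forall i j, i < m -> j < n -> once G i j) /\
  (forall i j, G i j -> 0 < i < m /\ 0 < j < n).

Definition good_pattern (m n : nat) (G : pattern) : Prop :=
  [/\ tiling_pattern m n G,
      forall i, 0 < i < m -> exists j, G i j,
      forall j, 0 < j < n -> exists i, G i j,
      exists i s, [/\ 0 < i < m, size s <= 2 & forall j, G i j -> j \in s]
    & exists j s, [/\ 0 < j < n, size s <= 2 & forall i, G i j -> i \in s]].

Definition transpose (G : pattern) : pattern :=
  fun i j => omap (fun h => (h.2, h.1)) (G j i).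

Lemma covers_transpose v x y :
  covers (omap (fun h => (h.2, h.1)) v) x y = covers v y x.
Proof. by case: v => [[[] []]|]; case: x; case: y. Qed.

Lemma good_pattern_transpose m n G :
  good_pattern m n G -> good_pattern n m (transpose G).
Proof.
have someE i j : isSome (transpose G i j) = isSome (G j i).
  by rewrite /transpose; case: (G j i).
case=> [[onceG bndG] rowG colG [i [s [im sz sG]]] [j [t [jn tz tG]]]].
split.
- split=> [k l kn lm|k l]; last by rewrite someE => /bndG[].
  have := onceG l k lm kn.
  rewrite /once /transpose !covers_transpose => /eqP <-.
  by apply/eqP; lia.
- by move=> k /colG[l Gl]; exists l; rewrite someE.
- by move=> k /rowG[l Gl]; exists l; rewrite someE.
- by exists j, t; split=> // k; rewrite someE; apply: tG.
- by exists i, s; split=> // k; rewrite someE; apply: sG.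
Qed.

(** Indexing the four corners by the position of the square in their blocks
    turns the count into existence and uniqueness of a pair of booleans. *)
Lemma once_ex1 G i j : once G i j ->
  exists x y : bool, covers (G (i + ~~ x) (j + ~~ y)) x y /\
    forall x' y' : bool, covers (G (i + ~~ x') (j + ~~ y')) x' y' ->
      x' = x /\ y' = y.
Proof.
rewrite /once => /eqP H.
have {}H : \sum_(x : bool) \sum_(y : bool)
    covers (G (i + ~~ x) (j + ~~ y)) x y = 1.
  by rewrite !big_bool /= !addn0 !addn1 -H; lia.
move: H; rewrite !big_bool /= !addn0 !addn1.
case E1: (covers (G i j) _ _); case E2: (covers (G i j.+1) _ _);
case E3: (covers (G i.+1 j) _ _); case E4: (covers (G i.+1 j.+1) _ _) => //= _.
- exists true, true; rewrite /= !addn0 E1; split=> // -[] [] /=;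
  by rewrite ?addn0 ?addn1 ?E2 ?E3 ?E4.
- exists true, false; rewrite /= !addn0 !addn1 E2; split=> // -[] [] /=;
  by rewrite ?addn0 ?addn1 ?E1 ?E3 ?E4.
- exists false, true; rewrite /= !addn0 !addn1 E3; split=> // -[] [] /=;
  by rewrite ?addn0 ?addn1 ?E2 ?E1 ?E4.
- exists false, false; rewrite /= !addn1 E4; split=> // -[] [] /=;
  by rewrite ?addn0 ?addn1 ?E2 ?E3 ?E1.
Qed.

(** * The tiling described by a pattern *)

Section Realisation.

Variables (m n : nat) (G : pattern).
Hypothesis tilG : tiling_pattern m n G.
Implicit Types a c : cell m n.

(** A cell [a] stands for the block whose upper left square is [a]; the centre
    of that block is the lower right corner of [a].  As no tromino has its
    centre on the boundary, all centres arise in this way. *)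
Definition centre a := G a.1.+1 a.2.+1.

Definition tile a : {set cell m n} :=
  [set c in block a | covers (centre a) (a.1 < c.1) (a.2 < c.2)].

Definition tiles : {set {set cell m n}} :=
  [set tile a | a : cell m n & centre a].

Lemma in_tile a c :
  c \in tile a = [&& a.1 <= c.1 <= a.1.+1, a.2 <= c.2 <= a.2.+1 &
                     covers (centre a) (a.1 < c.1) (a.2 < c.2)].
Proof. by rewrite inE [c \in block a]inE -andbA. Qed.

Lemma centre_bounds a : centre a -> a.1.+1 < m /\ a.2.+1 < n.
Proof. by move=> /(proj2 tilG) [/andP[_ ?] /andP[_ ?]]. Qed.

Lemma centre_ex i j : G i j ->
  exists a, [/\ a.1.+1 = i :> nat, a.2.+1 = j :> nat & centre a].
Proof.
move=> Gij; have [/andP[i0 im] /andP[j0 jn]] := proj2 tilG _ _ Gij.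
have im1 : i.-1 < m by lia.
have jn1 : j.-1 < n by lia.
by exists (Ordinal im1, Ordinal jn1); rewrite /centre /= !prednK.
Qed.

Lemma tile_cell a (x y : bool) : covers (centre a) x y ->
  exists2 c, c \in tile a & c.1 = a.1 + x :> nat /\ c.2 = a.2 + y :> nat.
Proof.
move=> cov; have Ga : centre a by case: (centre a) cov.
have [am an] := centre_bounds Ga.
have im : a.1 + x < m by lia.
have jn : a.2 + y < n by lia.
exists (Ordinal im, Ordinal jn) => //; rewrite in_tile /=.
have -> : (a.1 < a.1 + x) = x by case: (x); lia.
have -> : (a.2 < a.2 + y) = y by case: (y); lia.
by rewrite cov andbT; case: (x); case: (y); lia.
Qed.

(** Both halves of the partition property, covering and disjointness, follow
    from this. *)
Lemma tile_unique_centre c : exists2 a, c \in tile a &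
  forall a', c \in tile a' -> a' = a.
Proof.
have [x [y [cov uniq]]] :=
  once_ex1 (proj1 tilG _ _ (ltn_ord c.1) (ltn_ord c.2)).
have [|a [a1 a2 Ga]] := @centre_ex (c.1 + ~~ x) (c.2 + ~~ y).
  by case: (G _ _) cov.
have Ea : a.1 = c.1 + ~~ x - 1 :> nat /\ a.2 = c.2 + ~~ y - 1 :> nat by lia.
exists a.
  rewrite in_tile.
  have -> : (a.1 < c.1) = x by lia.
  have -> : (a.2 < c.2) = y by lia.
  by rewrite /centre a1 a2 cov andbT; lia.
move=> b; rewrite in_tile => /and3P[b1 b2].
have := uniq (b.1 < c.1) (b.2 < c.2); rewrite /centre.
have -> : c.1 + ~~ (b.1 < c.1) = b.1.+1 by lia.
have -> : c.2 + ~~ (b.2 < c.2) = b.2.+1 by lia.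
move=> H /H[xE yE].
rewrite (surjective_pairing a) (surjective_pairing b).
by congr pair; apply/ord_inj; lia.
Qed.

Lemma tile_tromino a : centre a -> tromino (tile a).
Proof.
move=> Ga; have [am an] := centre_bounds Ga.
case E: (centre a) Ga => [[x y]|] // _.
have im : a.1 + x < m by lia.
have jn : a.2 + y < n by lia.
exists a, (Ordinal im, Ordinal jn); split=> //.
  by rewrite inE /=; lia.
apply/setP => c; rewrite in_tile E in_setD1 [c \in block a]inE /covers.
rewrite (surjective_pairing c) !xpair_eqE -!val_eqE /=.
lia.
Qed.

(** Only one square is missing from the block, so each row of the block keeps a
    square; this is why a tromino crosses the lines through its centre. *)
Lemma tile_meets_row a (x : bool) : centre a ->
  exists2 c, c \in tile a & c.1 = a.1 + x :> nat.
Proof.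
case E: (centre a) => [h|] // _.
have [|c ca [c1 _]] := @tile_cell a x (h == (x, false)); last by exists c.
by rewrite E /=; case: h {E} => [[] []]; case: (x).
Qed.

Lemma tile_meets_col a (y : bool) : centre a ->
  exists2 c, c \in tile a & c.2 = a.2 + y :> nat.
Proof.
case E: (centre a) => [h|] // _.
have [|c ca [_ c2]] := @tile_cell a (h == (false, y)) y; last by exists c.
by rewrite E /=; case: h {E} => [[] []]; case: (y).
Qed.

Lemma tiles_tiling : tromino_tiling tiles.
Proof.
split; last by move=> _ /imsetP[a Ga ->]; apply: tile_tromino; rewrite inE in Ga.
apply/and3P; split.
- apply/eqP/setP => c; rewrite inE.
  have [a ca _] := tile_unique_centre c.
  apply/bigcupP; exists (tile a) => //; apply: imset_f; rewrite inE.
  by move: ca; rewrite in_tile => /and3P[_ _]; case: (centre a).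
- apply/trivIsetP => _ _ /imsetP[a _ ->] /imsetP[b _ ->] neq.
  apply/pred0P => c /=; apply/negP => /andP[ca cb].
  have [d _ dE] := tile_unique_centre c.
  by case/eqP: neq; rewrite (dE _ ca) (dE _ cb).
- apply/negP => /imsetP[a]; rewrite inE => /(tile_meets_row false)[c ca _] E.
  by move: ca; rewrite -E inE.
Qed.

Lemma tile_hcrosses a k : centre a -> hcrosses k (tile a) = (k == a.1.+1).
Proof.
move=> Ga; apply/andP/eqP => [[/exists_inP[c ca ck] /exists_inP[d da dk]]|->].
  by move: ca da; rewrite !in_tile => /andP[ca _] /andP[da _]; lia.
have [c ca c1] := tile_meets_row false Ga; have [d da d1] := tile_meets_row true Ga.
by split; apply/exists_inP; [exists c | exists d] => //; lia.
Qed.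

Lemma tile_vcrosses a k : centre a -> vcrosses k (tile a) = (k == a.2.+1).
Proof.
move=> Ga; apply/andP/eqP => [[/exists_inP[c ca ck] /exists_inP[d da dk]]|->].
  move: ca da; rewrite !in_tile => /and3P[_ ca _] /and3P[_ da _]; lia.
have [c ca c1] := tile_meets_col false Ga; have [d da d1] := tile_meets_col true Ga.
by split; apply/exists_inP; [exists c | exists d] => //; lia.
Qed.

(** Trominoes crossing the line [k] have distinct centres on it, so they are
    counted by the positions of these centres. *)
Lemma hcrossings_le k (s : seq nat) :
  (forall j, G k j -> j \in s) -> hcrossings tiles k <= size s.
Proof.
move=> sG; pose A := [set a | centre a && (k == a.1.+1)].
have sub : [set t in tiles | hcrosses k t] \subset tile @: A.
  apply/subsetP => t; rewrite inE => /andP[/imsetP[a Ga ->]].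
  rewrite inE in Ga; rewrite tile_hcrosses // => ka.
  by apply: imset_f; rewrite inE Ga.
apply: leq_trans (subset_leq_card sub) _.
apply: leq_trans (leq_imset_card _ _) _.
rewrite cardE -(size_map (fun a : cell m n => a.2.+1 : nat)).
apply: uniq_leq_size => [|_ /mapP[a + ->]].
  rewrite map_inj_in_uniq ?enum_uniq // => a b.
  rewrite !mem_enum !inE => /andP[_ /eqP ka] /andP[_ /eqP kb] ab.
  rewrite (surjective_pairing a) (surjective_pairing b).
  by congr pair; apply/ord_inj/succn_inj; rewrite // -ka -kb.
by rewrite mem_enum inE => /andP[Ga /eqP ka]; apply: sG; rewrite ka.
Qed.

Lemma vcrossings_le k (s : seq nat) :
  (forall i, G i k -> i \in s) -> vcrossings tiles k <= size s.
Proof.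
move=> sG; pose A := [set a | centre a && (k == a.2.+1)].
have sub : [set t in tiles | vcrosses k t] \subset tile @: A.
  apply/subsetP => t; rewrite inE => /andP[/imsetP[a Ga ->]].
  rewrite inE in Ga; rewrite tile_vcrosses // => ka.
  by apply: imset_f; rewrite inE Ga.
apply: leq_trans (subset_leq_card sub) _.
apply: leq_trans (leq_imset_card _ _) _.
rewrite cardE -(size_map (fun a : cell m n => a.1.+1 : nat)).
apply: uniq_leq_size => [|_ /mapP[a + ->]].
  rewrite map_inj_in_uniq ?enum_uniq // => a b.
  rewrite !mem_enum !inE => /andP[_ /eqP ka] /andP[_ /eqP kb] ab.
  rewrite (surjective_pairing a) (surjective_pairing b).
  by congr pair; apply/ord_inj/succn_inj; rewrite // -ka -kb.
by rewrite mem_enum inE => /andP[Ga /eqP ka]; apply: sG; rewrite ka.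
Qed.

End Realisation.

Lemma bigmin_le (x : nat) (r : seq nat) (F : nat -> nat) k :
  k \in r -> \big[minn/x]_(i <- r) F i <= F k.
Proof.
elim: r => // i r IHr; rewrite inE big_cons => /orP[/eqP->|/IHr]; lia.
Qed.

Lemma good_pattern_tiling m n G : good_pattern m n G ->
  exists T : {set {set cell m n}},
    [/\ tromino_tiling T, faultfree T,
        hcrossing_number T <= 2 & vcrossing_number T <= 2].
Proof.
case=> tilG rowG colG [i [s [im sz sG]]] [j [t [jn tz tG]]].
exists (tiles m n G); split.
- exact: tiles_tiling.
- move=> k; split=> -[kb nocross].
    have [l /(centre_ex tilG)[a [ak _ Ga]]] := rowG _ kb.
    have Ta : tile G a \in tiles m n G by apply: imset_f; rewrite inE.
    by have := nocross _ Ta; rewrite tile_hcrosses // ak eqxx.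
  have [l /(centre_ex tilG)[a [_ ak Ga]]] := colG _ kb.
  have Ta : tile G a \in tiles m n G by apply: imset_f; rewrite inE.
  by have := nocross _ Ta; rewrite tile_vcrosses // ak eqxx.
- apply: leq_trans (bigmin_le _ _ (_ : i \in index_iota 1 m)) _.
    by rewrite mem_index_iota.
  exact: leq_trans (hcrossings_le tilG sG) sz.
- apply: leq_trans (bigmin_le _ _ (_ : j \in index_iota 1 n)) _.
    by rewrite mem_index_iota.
  exact: leq_trans (vcrossings_le tilG tG) tz.
Qed.

(** * Repeating a strip of a pattern *)

Section Fold.

Variables q P a : nat.

(** [fold] sends a line of the pumped pattern to the line of the original
    pattern that it copies: the strip of lines from q to q + P - 1 occurs [a]
    times.  The lines outside the strip have a unique copy, given by
    [unfold]. *)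
Definition fold (i : nat) : nat :=
  if i < q then i else
  if i < q + a * P then q + (i - q) %% P else i + P - a * P.

Definition outside (i : nat) : bool := ~~ (q <= i < q + P).

Definition unfold (i : nat) : nat := if i < q then i else i + a * P - P.

Lemma fold_interior M i : 0 < q -> 0 < P -> q + P < M ->
  (0 < fold i < M) = (0 < i < M + a * P - P).
Proof.
move=> q0 P0 qPM.
rewrite /fold; move: (a * P) => A; have lt := ltn_pmod (i - q) P0.
by case: (ltnP i q) => iq; [|case: (ltnP i (q + A)) => iA]; lia.
Qed.

Lemma fold_unfold i : outside i -> fold (unfold i) = i.
Proof.
rewrite /outside /fold /unfold; move: (a * P) => A.
case: (ltnP i q) => [->//|iq] /= iqP.
by do 2! case: ltnP; lia.
Qed.

Lemma unfold_fold i : 0 < P -> outside (fold i) -> unfold (fold i) = i.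
Proof.
move=> P0.
rewrite /outside /fold /unfold; move: (a * P) => A.
have lt := ltn_pmod (i - q) P0.
case: (ltnP i q) => [->//|iq]; case: (ltnP i (q + A)) => iqA; first by lia.
by case: (ltnP (i + P - A) q); lia.
Qed.

(** The reason why pumping respects the tiling condition: next to the copy of a
    line always comes a copy of the next line.  At the end of each period the
    next line should be q + P but the strip restarts at q, or the converse when
    the strip is removed; the hypothesis identifies the two. *)
Lemma foldS (T : Type) (g : nat -> T) i :
  0 < P -> g q = g (q + P) -> g (fold i.+1) = g (fold i).+1.
Proof.
move=> P0 gq; rewrite /fold; have aP : a = 0 \/ a * P >= P by nia.
case: (ltnP i.+1 q) => [iq|iq]; first by rewrite (ltnW iq).
case: (ltnP i q) => iq'.
  have -> : i.+1 = q by lia.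
  by rewrite subnn mod0n addn0; case: ltnP => // ?; rewrite gq; congr g; lia.
have E : i.+1 - q = (i - q).+1 by lia.
case: (ltnP i (q + a * P)) => iqa; last first.
  by case: ltnP => ?; first lia; congr g; lia.
have modS : g (q + (i - q).+1 %% P) = g (q + (i - q) %% P).+1.
  have := modnS (i - q) P; case: ifP => [d|_] Em; last by rewrite Em addnS.
  rewrite Em addn0 gq -addnS; congr (g (_ + _)).
  have lt := ltn_pmod (i - q) P0; apply/eqP; rewrite eqn_leq lt andbT.
  rewrite dvdn_leq // /dvdn -addn1 modnDml addn1; exact: d.
case: ltnP => iaP; first by rewrite E.
have Ea : (i - q).+1 = a * P by lia.
by rewrite -modS Ea modnMl addn0 gq; congr g; lia.
Qed.

End Fold.

(** Crossings must be found outside the strips because the strips disappear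
    when they are repeated zero times, and the centres on the lines q + P and
    p + Q must lie outside them so as not to be multiplied. *)
Definition repeatable (M N q P p Q : nat) (G : pattern) : Prop :=
  [/\ tiling_pattern M N G,
      (forall j, G q j = G (q + P) j) /\ (forall i, G i p = G i (p + Q)),
      forall i, 0 < i < M -> exists2 j, outside p Q j & G i j,
      forall j, 0 < j < N -> exists2 i, outside q P i & G i j
    & (exists2 s, size s <= 2 &
        forall j, G (q + P) j -> outside p Q j /\ j \in s) /\
      (exists2 t, size t <= 2 &
        forall i, G i (p + Q) -> outside q P i /\ i \in t)].

Lemma repeat_good_pattern M N q P p Q G a b :
  0 < q -> 0 < P -> q + P < M -> 0 < p -> 0 < Q -> p + Q < N ->
  repeatable M N q P p Q G ->
  good_pattern (M + a * P - P) (N + b * Q - Q)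
    (fun i j => G (fold q P a i) (fold p Q b j)).
Proof.
move=> q0 P0 qPM p0 Q0 pQN.
case=> [[onceG bndG] [rowq colp] rowG colG [[s sz sG] [t tz tG]]].
have lineq : outside q P (q + P) by rewrite /outside; lia.
have linep : outside p Q (p + Q) by rewrite /outside; lia.
have rowS i j : G (fold q P a i.+1) j = G (fold q P a i).+1 j.
  by apply: (@foldS _ _ _ _ (fun i => G i j)).
have colS i j : G i (fold p Q b j.+1) = G i (fold p Q b j).+1.
  by apply: (@foldS _ _ _ _ (fun j => G i j)).
have fold_ltM i : i < M + a * P - P -> fold q P a i < M.
  case: i => [|i] im; first by rewrite /fold q0; lia.
  by have := fold_interior a i.+1 q0 P0 qPM; lia.
have fold_ltN j : j < N + b * Q - Q -> fold p Q b j < N.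
  case: j => [|j] jn; first by rewrite /fold p0; lia.
  by have := fold_interior b j.+1 p0 Q0 pQN; lia.
split.
- split=> i j.
    by move=> im jn; rewrite /once !rowS !colS; apply: onceG; auto.
  by move=> /bndG; rewrite !fold_interior.
- move=> i; rewrite -(fold_interior a _ q0 P0 qPM) => /rowG[j oj Gj].
  by exists (unfold p Q b j); rewrite fold_unfold.
- move=> j; rewrite -(fold_interior b _ p0 Q0 pQN) => /colG[i oi Gi].
  by exists (unfold q P a i); rewrite fold_unfold.
- exists (unfold q P a (q + P)), (map (unfold p Q b) s); split.
  + by rewrite -(fold_interior a _ q0 P0 qPM) fold_unfold //; lia.
  + by rewrite size_map.
  + move=> j; rewrite fold_unfold // => /sG[oj js].
    by rewrite -(unfold_fold Q0 oj) map_f.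
- exists (unfold p Q b (p + Q)), (map (unfold q P a) t); split.
  + by rewrite -(fold_interior b _ p0 Q0 pQN) fold_unfold //; lia.
  + by rewrite size_map.
  + move=> i; rewrite fold_unfold // => /tG[oi it].
    by rewrite -(unfold_fold P0 oi) map_f.
Qed.

(** * Three base patterns *)

(** The digits from 1 to 4 stand for the missing square in reading order: upper
    left, upper right, lower left, lower right; 0 means that the grid point is
    not a centre. *)
Definition hole_of (d : nat) : option (bool * bool) :=
  nth None [:: None; Some (false, false); Some (false, true);
               Some (true, false); Some (true, true)] d.

(** Only interior grid points are tabulated, so the first row and column of the
    table describe the lines 1; the boundary carries no centre. *)
Definition pattern_of (rows : seq (seq nat)) : pattern :=
  fun i j => if (i == 0) || (j == 0) then None
             else hole_of (nth 0 (nth [::] rows i.-1) j.-1).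

Definition repeatableb (M N q P p Q : nat) (rows : seq (seq nat)) : bool :=
  let G := pattern_of rows in
  [&& all (fun i => all (once G i) (iota 0 N)) (iota 0 M),
      size rows == M.-1, all (fun r => size r == N.-1) rows,
      all (fun j => G q j == G (q + P) j) (iota 0 N),
      all (fun i => G i p == G i (p + Q)) (iota 0 M),
      all (fun i => has (fun j => outside p Q j && G i j) (iota 0 N))
          (iota 1 M.-1),
      all (fun j => has (fun i => outside q P i && G i j) (iota 0 M))
          (iota 1 N.-1),
      let s := [seq j <- iota 0 N | G (q + P) j] in
      (size s <= 2) && all (outside p Q) s
    & let t := [seq i <- iota 0 M | G i (p + Q)] in
      (size t <= 2) && all (outside q P) t].

Lemma repeatableP M N q P p Q rows : 0 < M -> 0 < N ->
  repeatableb M N q P p Q rows -> repeatable M N q P p Q (pattern_of rows).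
Proof.
move=> M0 N0; set G := pattern_of rows.
case/and5P => /allP onceG /eqP szM /allP szN /allP rowq.
case/and5P => /allP colp /allP rowG /allP colG.
move=> /andP[sz /allP sG] /andP[tz /allP tG].
have bndG i j : G i j -> 0 < i < M /\ 0 < j < N.
  rewrite /G /pattern_of; case: i j => [|i] [|j] //=.
  case: (ltnP i (size rows)) => [ir|ir]; last first.
    by rewrite nth_default // nth_default.
  have /eqP szr := szN _ (mem_nth [::] ir).
  case: (ltnP j (size (nth [::] rows i))) => jr; last by rewrite nth_default.
  move: ir jr; rewrite szM szr => ir jr _; lia.
have none i j : (M <= i) || (N <= j) -> G i j = None.
  case E: (G i j) => // out.
  by have [] : 0 < i < M /\ 0 < j < N; [apply: bndG; rewrite E | lia].
split.
- split=> // i j im jn.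
  by apply: (allP (onceG i _)); rewrite mem_iota.
- split=> [j|i].
    case: (ltnP j N) => jn; last by rewrite !none ?jn ?orbT.
    by apply/eqP/rowq; rewrite mem_iota.
  case: (ltnP i M) => im; last by rewrite !none ?im.
  by apply/eqP/colp; rewrite mem_iota.
- move=> i iM; have /rowG/hasP[j _ /andP[? ?]] : i \in iota 1 M.-1.
    by rewrite mem_iota; lia.
  by exists j.
- move=> j jN; have /colG/hasP[i _ /andP[? ?]] : j \in iota 1 N.-1.
    by rewrite mem_iota; lia.
  by exists i.
split.
- exists [seq j <- iota 0 N | G (q + P) j] => // j Gj.
  have js : j \in [seq j <- iota 0 N | G (q + P) j].
    by rewrite mem_filter Gj mem_iota; have [] := bndG _ _ Gj; lia.
  by split=> //; apply: sG.
- exists [seq i <- iota 0 M | G i (p + Q)] => // i Gi.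
  have js : i \in [seq i <- iota 0 M | G i (p + Q)].
    by rewrite mem_filter Gi mem_iota; have [] := bndG _ _ Gi; lia.
  by split=> //; apply: tG.
Qed.

(** Each base contains one copy of its strips: [base_m_n] is a tiling of
    R(m + P, n + Q), and removing both strips leaves a tiling of R(m, n).  Here
    P = 3 and Q = 2, with strips starting at row 3 and column 4. *)
Definition base_12_10 : seq (seq nat) :=
  [:: [:: 3; 0; 3; 0; 4; 0; 3; 0; 4; 0; 3];
    [:: 2; 0; 2; 0; 1; 0; 2; 0; 0; 3; 0];
    [:: 0; 0; 0; 0; 0; 0; 0; 0; 3; 0; 1];
    [:: 4; 0; 4; 0; 4; 0; 4; 0; 2; 0; 0];
    [:: 1; 0; 1; 0; 1; 0; 1; 0; 0; 0; 4];
    [:: 0; 0; 0; 0; 0; 0; 0; 0; 3; 0; 1];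
    [:: 2; 3; 0; 3; 0; 3; 0; 4; 0; 0; 0];
    [:: 0; 0; 0; 2; 0; 2; 0; 0; 3; 0; 3];
    [:: 2; 3; 0; 0; 0; 0; 0; 3; 0; 0; 2];
    [:: 0; 0; 1; 0; 4; 0; 3; 0; 1; 0; 0];
    [:: 3; 0; 0; 0; 1; 0; 2; 0; 0; 0; 3];
    [:: 2; 0; 3; 0; 0; 0; 0; 0; 4; 0; 2];
    [:: 0; 1; 0; 0; 4; 0; 3; 0; 0; 2; 0];
    [:: 2; 0; 1; 0; 1; 0; 2; 0; 2; 0; 1]].

(** P = 6 and Q = 2, with strips starting at row 3 and column 4. *)
Definition base_12_11 : seq (seq nat) :=
  [:: [:: 3; 0; 3; 0; 4; 0; 3; 0; 3; 0; 2; 3];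
    [:: 2; 0; 2; 0; 1; 0; 2; 0; 2; 0; 0; 0];
    [:: 0; 0; 0; 0; 0; 0; 0; 0; 0; 1; 0; 3];
    [:: 4; 0; 4; 0; 4; 0; 4; 1; 0; 0; 0; 2];
    [:: 1; 0; 1; 0; 1; 0; 0; 0; 0; 4; 0; 0];
    [:: 0; 0; 0; 0; 0; 0; 4; 1; 0; 1; 0; 3];
    [:: 4; 0; 4; 0; 4; 0; 0; 0; 0; 0; 0; 2];
    [:: 1; 0; 1; 0; 1; 0; 4; 1; 0; 4; 0; 0];
    [:: 0; 0; 0; 0; 0; 0; 0; 0; 0; 1; 0; 3];
    [:: 2; 3; 0; 3; 0; 3; 0; 3; 0; 0; 0; 2];
    [:: 0; 0; 0; 2; 0; 2; 0; 2; 0; 3; 0; 0];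
    [:: 2; 3; 0; 0; 0; 0; 0; 0; 0; 2; 0; 3];
    [:: 0; 0; 1; 0; 4; 0; 2; 3; 0; 0; 0; 2];
    [:: 3; 0; 0; 0; 1; 0; 0; 0; 0; 3; 0; 0];
    [:: 2; 0; 3; 0; 0; 0; 4; 0; 3; 0; 0; 3];
    [:: 0; 1; 0; 0; 4; 0; 0; 4; 0; 0; 3; 0];
    [:: 2; 0; 1; 0; 1; 0; 2; 0; 2; 3; 0; 1]].

(** P = 6 and Q = 2, with strips starting at row 3 and column 3. *)
Definition base_15_11 : seq (seq nat) :=
  [:: [:: 3; 0; 3; 0; 3; 0; 3; 0; 2; 3; 0; 3];
    [:: 2; 0; 2; 0; 2; 0; 2; 0; 0; 0; 0; 2];
    [:: 0; 0; 0; 0; 0; 0; 0; 1; 0; 3; 0; 0];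
    [:: 4; 1; 0; 4; 0; 4; 0; 0; 0; 2; 0; 4];
    [:: 0; 0; 0; 1; 0; 1; 0; 4; 0; 0; 0; 1];
    [:: 4; 1; 0; 0; 0; 0; 0; 1; 0; 3; 0; 0];
    [:: 0; 0; 0; 4; 0; 4; 0; 0; 0; 2; 0; 4];
    [:: 4; 1; 0; 1; 0; 1; 0; 4; 0; 0; 0; 1];
    [:: 0; 0; 0; 0; 0; 0; 0; 1; 0; 3; 0; 0];
    [:: 2; 3; 0; 4; 0; 3; 0; 0; 0; 2; 0; 3];
    [:: 0; 0; 0; 1; 0; 2; 0; 3; 0; 0; 0; 2];
    [:: 2; 3; 0; 0; 0; 0; 0; 2; 0; 3; 0; 0];
    [:: 0; 0; 0; 4; 0; 3; 0; 0; 0; 2; 0; 3];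
    [:: 2; 3; 0; 1; 0; 2; 0; 3; 0; 0; 0; 2];
    [:: 0; 0; 0; 0; 0; 0; 0; 2; 0; 3; 0; 0];
    [:: 2; 3; 0; 4; 0; 4; 0; 0; 0; 2; 0; 3];
    [:: 0; 0; 0; 1; 0; 0; 2; 3; 0; 0; 1; 0];
    [:: 2; 3; 0; 0; 0; 2; 0; 0; 0; 2; 0; 1];
    [:: 0; 0; 0; 4; 0; 0; 0; 3; 0; 0; 0; 0];
    [:: 2; 3; 0; 1; 0; 2; 3; 0; 1; 0; 2; 3]].

Lemma good_pattern_ex m n : 10 <= m -> 10 <= n -> 3 %| m ->
  exists G, good_pattern m n G.
Proof.
move=> m10 n10 /dvdnP[k Em].
have base M N q P p Q rows a b :
    [&& 0 < q, 0 < P, q + P < M, 0 < p, 0 < Q & p + Q < N] ->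
    repeatableb M N q P p Q rows ->
    m = M + a * P - P -> n = N + b * Q - Q -> exists G, good_pattern m n G.
  move=> /and5P[q0 P0 qM p0 /andP[Q0 pN]] rep -> ->.
  eexists; apply: (repeat_good_pattern a b q0 P0 qM p0 Q0 pN).
  by apply: repeatableP rep; lia.
(* As m = 3 k, the parity of k decides between 12 and 15 modulo 6. *)
case En: (odd n).
  case Ek: (odd k).
    apply: (@base 21 13 3 6 3 2 base_15_11 (k - 5)./2 (n - 11)./2) => //; lia.
  apply: (@base 18 13 3 6 4 2 base_12_11 (k - 4)./2 (n - 11)./2) => //; lia.
by apply: (@base 15 12 3 3 4 2 base_12_10 (k - 4) (n - 10)./2) => //; lia.
Qed.

Theorem theorem3 (m n : nat) (hm : 10 <= m) (hn : 10 <= n) (hmn : 3 %| m * n) :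
  exists T : {set {set cell m n}},
    [/\ tromino_tiling T,
        faultfree T,
        hcrossing_number T <= 2
      & vcrossing_number T <= 2].
Proof.
suff [G goodG] : exists G, good_pattern m n G by apply: good_pattern_tiling goodG.
move: hmn; rewrite Euclid_dvdM // => /orP[m3|n3]; first exact: good_pattern_ex.
have [G goodG] := good_pattern_ex hn hm n3.
by exists (transpose G); apply: good_pattern_transpose.
Qed.
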